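(* Let $G$ be a connected nilpotent Lie group with a degree-$k$ filtration $G_\bullet=(G_i)_{i\ge 0}$ of closed subgroups, let $\Gamma\le G$ be a discrete subgroup, and for each $i\in\{1,\dots,k\}$ let $\Gamma_i=\Gamma\cap G_i$. Let $X$ denote the coset space $G/\Gamma$ equipped with the sets $\mathrm{C}^n(X)=\{\pi_\Gamma\circ c: c\in \mathrm{C}^n(G_\bullet)\}$, $n\ge 0$, where $\pi_\Gamma:G\to G/\Gamma$ is the quotient map. Then $X$ is a connected compact nilspace if and only if $\Gamma_i$ is cocompact in $G_i$ for each $i\in\{1,\dots,k\}$.
   Context: Nilspaces. A morphism of discrete cubes $\{0,1\}^m\to\{0,1\}^n$ is a map that is the restriction of an affine homomorphism $\mathbb{Z}^m\to\mathbb{Z}^n$. A cubespace is a set $X$ with sets $\mathrm{C}^n(X)\subset X^{\{0,1\}^n}$ ($n\ge 0$), $\mathrm{C}^0(X)=X$, such that $c\circ\phi\in \mathrm{C}^m(X)$ for every $c\in \mathrm{C}^n(X)$ and every morphism $\phi:\{0,1\}^m\to\{0,1\}^n$. A nilspace is a non-empty cubespace $X$ satisfying ergodicity: $\mathrm{C}^1(X)=X^{\{0,1\}}$; and corner completion: for every $n\ge1$ and every $c':\{0,1\}^n\setminus\{1^n\}\to X$ whose restriction to each $(n-1)$-dimensional face containing $0^n$ is in $\mathrm{C}^{n-1}(X)$ (such a $c'$ is an $n$-corner), there is $c\in \mathrm{C}^n(X)$ with $c(v)=c'(v)$ for all $v\ne 1^n$. Compactness. ''Compact space'' means compact Hausdorff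 second-countable topological space. A compact nilspace is a nilspace $X$ that is a compact space and such that $\mathrm{C}^n(X)$ is closed in $X^{\{0,1\}^n}$ for every $n$. It is connected if the underlying topological space is connected. Here $G/\Gamma$ (left cosets $g\Gamma$) has the quotient topology. Filtrations. A filtration $G_\bullet$ on a group $G$ is a sequence of subgroups $G=G_0=G_1\ge G_2\ge\cdots$ with $[G_i,G_j]\subset G_{i+j}$ for all $i,j$; it has degree $k$ if $G_{k+1}=\{\mathrm{id}_G\}$. For a face $F$ of $\{0,1\}^n$ (a set obtained by fixing some coordinates; the number of fixed coordinates is the codimension $\mathrm{codim}(F)$) and $g\in G$, $g^F\in G^{\{0,1\}^n}$ equals $g$ on $F$ and $\mathrm{id}_G$ elsewhere. $\mathrm{C}^n(G_\bullet)$ is the subgroup of $G^{\{0,1\}^n}$ generated by all $g^F$ with $F$ a face of $\{0,1\}^n$ and $g\in G_{\mathrm{codim}(F)}$. A subgroup $\Gamma_i\le G_i$ is cocompact if $G_i/\Gamma_i$ is compact. *)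

(* Defs.v *)
From HB Require Import structures.
From mathcomp Require Import all_boot all_order all_algebra.
From mathcomp Require Import generic_quotient.
From mathcomp Require Import all_classical all_reals all_analysis.
Import numFieldNormedType.Exports.

Set Implicit Arguments.
Unset Strict Implicit.
Unset Printing Implicit Defensive.

Import Order.TTheory GRing.Theory Num.Theory.
Local Open Scope classical_set_scope.
Local Open Scope group_scope.
Local Open Scope quotient_scope.

(** * Groups and subgroups *)

Section FunctionGroup.
Variables (I : Type) (G : groupType).
Implicit Types f g h : I -> G.

Let fmul f g : I -> G := fun i => f i * g i.
Let fone : I -> G := fun=> 1.
Let finv f : I -> G := fun i => (f i)^-1.

Let fmulA : associative fmul.
Proof. by move=> f g h; apply: funext => i; rewrite /fmul mulgA. Qed.
Let fmul1 : left_id fone fmul.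
Proof. by move=> f; apply: funext => i; rewrite /fmul mul1g. Qed.
Let fmulr1 : right_id fone fmul.
Proof. by move=> f; apply: funext => i; rewrite /fmul mulg1. Qed.
Let fmulV : left_inverse fone finv fmul.
Proof. by move=> f; apply: funext => i; rewrite /fmul mulVg. Qed.
Let fmulrV : right_inverse fone finv fmul.
Proof. by move=> f; apply: funext => i; rewrite /fmul mulgV. Qed.

HB.instance Definition _ :=
  isGroup.Build (I -> G) fmulA fmul1 fmulr1 fmulV fmulrV.
End FunctionGroup.

Definition is_subgroup (G : groupType) (A : set G) : Prop :=
  A 1 /\ forall x y, A x -> A y -> A (x * y^-1).

Record subgroup (G : groupType) := Subgroup {
  subgroup_set :> set G;
  subgroupP : is_subgroup subgroup_set }.

Definition generated (G : groupType) (A : set G) : set G :=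
  smallest (@is_subgroup G) A.

Definition commutator_subgroup (G : groupType) (A B : set G) : set G :=
  generated [set [~ x, y] | x in A & y in B].

Fixpoint lower_central_series {G : groupType} (n : nat) : set G :=
  if n is n'.+1 then commutator_subgroup setT (lower_central_series n')
  else setT.

Definition nilpotent_group (G : groupType) : Prop :=
  exists n, lower_central_series n = [set 1 : G].

Section SubgroupGroup.
Variables (G : groupType) (H : subgroup G).
Implicit Types x y z : set_type H.

Lemma subgroup1 : (1 : G) \in (H : set G).
Proof. by apply/mem_set; case: (subgroupP H). Qed.
Lemma subgroupV (x : G) : x \in (H : set G) -> x^-1 \in (H : set G).
Proof.
move=> /set_mem Hx; apply/mem_set; case: (subgroupP H) => H1 HB.
by rewrite -[x^-1]mul1g; exact: HB.
Qed.
Lemma subgroupM (x y : G) :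
  x \in (H : set G) -> y \in (H : set G) -> x * y \in (H : set G).
Proof.
move=> Hx /subgroupV/set_mem Hy; apply/mem_set.
by case: (subgroupP H) => _ HB; rewrite -[y]invgK; apply: HB => //; exact: set_mem.
Qed.

Let smul x y : set_type H := exist _ (sval x * sval y) (subgroupM (svalP x) (svalP y)).
Let sone : set_type H := exist _ 1 subgroup1.
Let sinv x : set_type H := exist _ (sval x)^-1 (subgroupV (svalP x)).

Let smulA : associative smul.
Proof. by move=> x y z; apply: eq_sig_hprop => //=; exact: mulgA. Qed.
Let smul1 : left_id sone smul.
Proof. by move=> x; apply: eq_sig_hprop => //=; exact: mul1g. Qed.
Let smulr1 : right_id sone smul.
Proof. by move=> x; apply: eq_sig_hprop => //=; exact: mulg1. Qed.
Let smulV : left_inverse sone sinv smul.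
Proof. by move=> x; apply: eq_sig_hprop => //=; exact: mulVg. Qed.
Let smulrV : right_inverse sone sinv smul.
Proof. by move=> x; apply: eq_sig_hprop => //=; exact: mulgV. Qed.

HB.instance Definition _ :=
  isGroup.Build (set_type H) smulA smul1 smulr1 smulV smulrV.
End SubgroupGroup.

(** * Topological groups *)

HB.mixin Record isTopologicalGroup G & Topological G & Group G := {
  mulg_continuous : continuous (fun z : G * G => z.1 * z.2);
  invg_continuous : continuous (fun x : G => x^-1) }.

#[short(type="topologicalGroupType")]
HB.structure Definition TopologicalGroup :=
  { G of Topological G & Group G & isTopologicalGroup G }.

Section SubgroupTopology.
Variables (G : topologicalGroupType) (H : subgroup G).

Let sub_mul_continuous :
  continuous (fun z : set_type H * set_type H => z.1 * z.2).
Proof.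
apply: continuous_comp_initial => z.
apply: (@continuous_comp _ _ _
  (fun z : set_type H * set_type H => (sval z.1, sval z.2))
  (fun z : G * G => z.1 * z.2)); last exact: mulg_continuous.
apply: cvg_pair.
- apply: (@continuous_comp _ _ _ fst (set_val : set_type H -> G)).
    exact: cvg_fst.
  exact: initial_continuous.
- apply: (@continuous_comp _ _ _ snd (set_val : set_type H -> G)).
    exact: cvg_snd.
  exact: initial_continuous.
Qed.

Let sub_inv_continuous : continuous (fun x : set_type H => x^-1).
Proof.
apply: continuous_comp_initial => x.
apply: (@continuous_comp _ _ _ (set_val : set_type H -> G) (fun y : G => y^-1)).
- exact: initial_continuous.
- exact: invg_continuous.
Qed.

HB.instance Definition _ :=
  isTopologicalGroup.Build (set_type H) sub_mul_continuous sub_inv_continuous.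
End SubgroupTopology.

Definition discrete_subset (T : topologicalType) (A : set T) : Prop :=
  forall x : set_type A, open [set x].

(* By convention compact spaces are Hausdorff and second countable. *)
Definition compact_space (T : topologicalType) : Prop :=
  [/\ compact [set: T], hausdorff_space T & @second_countable T].

(** * Coset spaces *)

Section CosetSpace.
Variables (G : topologicalGroupType) (K : subgroup G).

Definition left_coset_rel : rel G :=
  fun x y => x^-1 * y \in (K : set G).

Lemma left_coset_equiv : equiv_class_of left_coset_rel.
Proof.
split; rewrite /left_coset_rel.
- by move=> x; rewrite mulVg subgroup1.
- by move=> x y; apply/idP/idP => /subgroupV; rewrite invgM invgK.
- by move=> y x z /subgroupM Kxy /Kxy; rewrite mulgA mulgK.
Qed.

Canonical left_coset_equiv_rel := EquivRelPack left_coset_equiv.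

Definition coset_space : topologicalType :=
  quotient_topology {eq_quot left_coset_equiv_rel}.

Definition coset_proj (x : G) : coset_space := \pi_(coset_space) x.

End CosetSpace.

(* The intersection of K and H, as a subgroup of H. *)
Section TraceSubgroup.
Variables (G : groupType) (K H : subgroup G).

Lemma trace_subgroupP :
  is_subgroup ([set x | (K : set G) (set_val x)] : set (set_type H)).
Proof. by case: (subgroupP K) => K1 KB; split => //= x y; exact: KB. Qed.

Definition trace_subgroup : subgroup (set_type H) := Subgroup trace_subgroupP.
End TraceSubgroup.

Definition cocompact (G : topologicalGroupType) (K : subgroup G) : Prop :=
  compact_space (coset_space K).

(** * Lie groups *)

Section Smooth.
Variable R : realType.
Local Open Scope ring_scope.

(* Meaningful for open U: continuity and existence of all partial derivatives
   up to order k, at every point of U. *)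
Fixpoint Ck_on (k m n : nat) (U : set 'rV[R]_m) (f : 'rV[R]_m -> 'rV[R]_n)
    : Prop :=
  (forall x, U x -> {for x, continuous f}) /\
  if k is k'.+1 then
    forall i : 'I_m, (forall x, U x -> derivable f x (delta_mx 0 i)) /\
      Ck_on k' U (fun x => 'D_(delta_mx 0 i) f x)
  else True.

Definition smooth_on (m n : nat) (U : set 'rV[R]_m)
    (f : 'rV[R]_m -> 'rV[R]_n) : Prop := forall k, Ck_on k U f.

(* [chart_map] matters only on [chart_dom], and [chart_inv] only on the image
   of [chart_dom]. *)
Record chart (M : Type) (d : nat) := Chart {
  chart_dom : set M;
  chart_map : M -> 'rV[R]_d;
  chart_inv : 'rV[R]_d -> M }.

Definition is_chart (M : topologicalType) d (c : chart M d) : Prop :=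
  [/\ open (chart_dom c),
      open (chart_map c @` chart_dom c),
      (forall x, chart_dom c x -> chart_inv c (chart_map c x) = x),
      (forall x, chart_dom c x -> {for x, continuous (chart_map c)}) &
      (forall y, (chart_map c @` chart_dom c) y ->
        {for y, continuous (chart_inv c)})].

Definition smooth_in_charts (M N : topologicalType) d e
    (A : set (chart M d)) (B : set (chart N e)) (f : M -> N) : Prop :=
  forall a b, A a -> B b ->
    smooth_on (chart_map a @` (chart_dom a `&` f @^-1` chart_dom b))
              (chart_map b \o f \o chart_inv a).

(* The atlas need not be maximal: smoothness of maps is the same for an atlas
   and for the maximal atlas that it generates. *)
Definition smooth_atlas (M : topologicalType) d (A : set (chart M d)) : Prop :=
  [/\ A `<=` @is_chart M d,
      \bigcup_(a in A) chart_dom a = setT &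
      smooth_in_charts A A idfun].

Definition smooth_map (M N : topologicalType) d e
    (A : set (chart M d)) (B : set (chart N e)) (f : M -> N) : Prop :=
  continuous f /\ smooth_in_charts A B f.

Definition prod_chart (M N : Type) d e (a : chart M d) (b : chart N e)
    : chart (M * N)%type (d + e)%N :=
  Chart (chart_dom a `*` chart_dom b)
        (fun z => row_mx (chart_map a z.1) (chart_map b z.2))
        (fun v => (chart_inv a (lsubmx v), chart_inv b (rsubmx v))).

Definition prod_atlas (M N : Type) d e
    (A : set (chart M d)) (B : set (chart N e))
    : set (chart (M * N)%type (d + e)%N) :=
  [set prod_chart a b | a in A & b in B].

(* Manifolds are Hausdorff and second countable. *)
Definition lie_group (G : topologicalGroupType) : Prop :=
  [/\ hausdorff_space G, @second_countable G &
      exists (d : nat) (A : set (chart G d)),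
        [/\ smooth_atlas A,
            smooth_map (prod_atlas A A) A (fun z : G * G => (z.1 * z.2)%g) &
            smooth_map A A (fun x : G => x^-1%g)]].

End Smooth.

(** * Discrete cubes and nilspaces *)

(* Vertices are 0/1 vectors, with true standing for 1. *)
Definition cube (n : nat) : Type := {ffun 'I_n -> bool}.

Definition cube_vec n (v : cube n) : 'rV[int]_n := (\row_i (v i)%:R)%R.

Definition cube_morphism m n (phi : cube m -> cube n) : Prop :=
  exists (h : {additive 'rV[int]_m -> 'rV[int]_n}) (b : 'rV[int]_n),
    forall v, cube_vec (phi v) = (h (cube_vec v) + b)%R.

Definition cube1 n : cube n := [ffun=> true].

Definition is_cubespace (X : Type) (C : forall n, set (cube n -> X)) : Prop :=
  C 0 = setT /\
  forall m n (phi : cube m -> cube n) (c : cube n -> X),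
    cube_morphism phi -> C n c -> C m (c \o phi).

(* The identification of the n-cube with the face {v | v i = 0} of the
   (n+1)-cube. *)
Definition lower_face n (i : 'I_n.+1) (w : cube n) : cube n.+1 :=
  [ffun j => if unlift i j is Some k then w k else false].

Definition punctured_cube n : Type := {v : cube n | v != cube1 n}.

Lemma lower_face_neq1 n (i : 'I_n.+1) (w : cube n) :
  lower_face i w != cube1 n.+1.
Proof. by apply/eqP => /ffunP/(_ i); rewrite !ffunE unlift_none. Qed.

Definition punctured_face n (i : 'I_n.+1) (w : cube n) : punctured_cube n.+1 :=
  exist _ (lower_face i w) (lower_face_neq1 i w).

(* The (n-1)-faces containing 0^n are the sets {v | v i = 0}. *)
Definition is_corner (X : Type) (C : forall n, set (cube n -> X)) n
    (c' : punctured_cube n.+1 -> X) : Prop :=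
  forall i : 'I_n.+1, C n (c' \o punctured_face i).

Definition ergodic (X : Type) (C : forall n, set (cube n -> X)) : Prop :=
  C 1%N = setT.

Definition corner_completion (X : Type) (C : forall n, set (cube n -> X))
    : Prop :=
  forall n (c' : punctured_cube n.+1 -> X), is_corner C c' ->
    exists2 c, C n.+1 c & forall v : punctured_cube n.+1, c (sval v) = c' v.

Definition nilspace (X : Type) (C : forall n, set (cube n -> X)) : Prop :=
  [/\ [set: X] !=set0, is_cubespace C, ergodic C & corner_completion C].

Definition compact_nilspace (X : topologicalType)
    (C : forall n, set (cube n -> X)) : Prop :=
  [/\ nilspace C, compact_space X &
      forall n, closed (C n : set {ptws cube n -> X})].

Definition connected_compact_nilspace (X : topologicalType)
    (C : forall n, set (cube n -> X)) : Prop :=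
  compact_nilspace C /\ connected [set: X].

(** * Filtrations and their cubes *)

Definition filtration (G : groupType) (F : nat -> subgroup G) : Prop :=
  [/\ (F 0 : set G) = setT,
      (F 1%N : set G) = setT,
      (forall i, (F i.+1 : set G) `<=` F i) &
      (forall i j, commutator_subgroup (F i) (F j) `<=` F (i + j)%N)].

Definition filtration_degree (G : groupType) (F : nat -> subgroup G) (k : nat)
    : Prop := (F k.+1 : set G) = [set 1].

(* A face is given by its fixed coordinates: coordinate i is fixed to b when
   p i = Some b and free when p i = None. *)
Definition face_spec (n : nat) : Type := {ffun 'I_n -> option bool}.

Definition face n (p : face_spec n) : {set cube n} :=
  [set v : cube n | [forall i, if p i is Some b then v i == b else true]]%SET.

Definition codim n (p : face_spec n) : nat := #|[set i | isSome (p i)]%SET|.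

Definition face_elt (G : groupType) n (p : face_spec n) (g : G) : cube n -> G :=
  fun v => if v \in face p then g else 1.

Definition group_cubes (G : groupType) (F : nat -> subgroup G) (n : nat)
    : set (cube n -> G) :=
  generated [set c | exists (p : face_spec n) (g : G),
    (F (codim p) : set G) g /\ c = face_elt p g].

Arguments group_cubes {G} F n _.

Definition coset_cubes (G : topologicalGroupType) (F : nat -> subgroup G)
    (K : subgroup G) (n : nat) : set (cube n -> coset_space K) :=
  [set coset_proj K \o c | c in group_cubes F n].

Arguments coset_cubes {G} F K n _.

(* Main.v *)
Require Import Defs.
From mathcomp Require Import all_boot all_order all_algebra.
From mathcomp Require Import all_classical all_reals all_analysis.
From mathcomp Require Import zify.

(* A function on the (n+1)-cube with lower and upper faces c0 and c1 is in
   C^(n+1)(G) if and only if c0 is in C^n(G) and c0^-1 c1 is in C^n of the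
   shifted filtration i |-> G_(i+1). By induction on n, a cube of G that is
   Gamma-valued strictly below a vertex v takes at v a value in G_|v| Gamma. Hence
   corners of G/Gamma lift to G, one vertex at a time, and G/Gamma is always a
   nilspace.

   If G_i = D_i Gamma_i with D_i compact for all i, the same recursion writes every
   cube of G as a cube from a fixed compact set times a Gamma-valued one, so
   C^n(G/Gamma) is compact, hence closed.

   Conversely, the image Y of G_i in G/Gamma consists of the points x such that the
   map with value x at 1^i and Gamma elsewhere is in C^i(G/Gamma), so Y is compact.
   As G_i is sigma-compact, Baire's theorem gives a compact subset of G_i whose
   image has an interior point in Y; finitely many of its translates by elements
   of G_i then have an image covering Y. *)

Set Implicit Arguments.
Unset Strict Implicit.
Unset Printing Implicit Defensive.

Import Order.TTheory GRing.Theory Num.Theory.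
Import numFieldNormedType.Exports.

Local Open Scope classical_set_scope.
Local Open Scope group_scope.

(** * Subgroups and faces of discrete cubes *)

Section Subgroups.
Variable G : groupType.
Implicit Types (H : subgroup G) (x y : G) (A B : set G).

Lemma subg1 H : (H : set G) 1.
Proof. by case: (subgroupP H). Qed.

Lemma subgM H x y : (H : set G) x -> (H : set G) y -> (H : set G) (x * y).
Proof. by move=> /mem_set Hx /mem_set Hy; apply: set_mem; exact: subgroupM. Qed.

Lemma subgV H x : (H : set G) x -> (H : set G) x^-1.
Proof. by move=> /mem_set Hx; apply: set_mem; exact: subgroupV. Qed.

Lemma generated_is_subgroup A : is_subgroup (generated A).
Proof.
split=> [B [sB AB]|x y gx gy B [sB AB]]; first by case: sB.
by case: (sB) => _; apply; [exact: gx|exact: gy].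
Qed.

Lemma sub_generated A : A `<=` generated A.
Proof. by move=> x Ax B [_]; exact. Qed.

Lemma generated_sub A H : A `<=` H -> generated A `<=` H.
Proof. by move=> AH x; apply; split=> //; exact: subgroupP. Qed.

Lemma mk_subgroup A : A 1 -> (forall x y, A x -> A y -> A (x * y)) ->
  (forall x, A x -> A x^-1) -> is_subgroup A.
Proof. by move=> A1 AM AV; split=> // x y Ax /AV; exact: AM. Qed.

End Subgroups.

Section Cofaces.
Variable n : nat.
Implicit Types (E : {set cube n}) (p : face_spec n).

(** The empty set and the inequality are allowed because intersections of faces, and their preimages
    under cube morphisms, can be empty or of smaller codimension than expected. As filtrations
    decrease, elements of [F m] may be placed on any such set. *)
Definition coface E m := E = finset.set0 \/ exists2 p, E = face p & (codim p <= m)%N.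

Lemma in_face p (v : cube n) :
  (v \in face p) = [forall i, if p i is Some b then v i == b else true].
Proof. by rewrite inE. Qed.

Lemma cofaceT : coface [set: cube n]%SET 0.
Proof.
right; exists [ffun=> None].
  by apply/setP => v; rewrite in_face inE; apply/esym/forallP => i; rewrite ffunE.
rewrite leqn0 /codim cards_eq0; apply/eqP/setP => i.
by rewrite !inE ffunE.
Qed.

Lemma coface_coord i b : coface [set v : cube n | v i == b]%SET 1.
Proof.
right; exists [ffun j => if j == i then Some b else None].
  apply/setP => v; rewrite in_face inE; apply/idP/forallP => [vi j|/(_ i)].
    by rewrite ffunE; case: eqVneq => // ->.
  by rewrite ffunE eqxx.
rewrite /codim (_ : finset _ = [set i]%SET) ?cards1 //.
by apply/setP => j; rewrite !inE ffunE; case: eqVneq.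
Qed.

Lemma cofaceI E E' m m' :
  coface E m -> coface E' m' -> coface (E :&: E')%SET (m + m').
Proof.
move=> [->|[p -> pm]]; first by left; rewrite finset.set0I.
move=> [->|[p' -> pm']]; first by left; rewrite finset.setI0.
have [->|[u]] := finset.set_0Vmem (face p :&: face p')%SET; first by left.
rewrite inE !in_face => /andP[/forallP up /forallP up'].
right; exists [ffun i => if p i is Some b then Some b else p' i].
  apply/setP => v; rewrite inE !in_face; apply/andP/forallP.
    move=> [/forallP vp /forallP vp'] i; rewrite ffunE.
    by move: (vp i) (vp' i); case: (p i).
  (* The common vertex [u] shows that [p] and [p'] prescribe the same value wherever both fix a
     coordinate. *)
  move=> vq; split; apply/forallP => i; move: (vq i) (up i) (up' i);
    rewrite ffunE; case: (p i) => // b.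
  by case: (p' i) => // b' /eqP-> /eqP-> .
apply: leq_trans (leq_add pm pm'); rewrite /codim.
apply: leq_trans (leq_card_setU _ _); apply/subset_leq_card/fintype.subsetP => i.
by rewrite !inE ffunE; case: (p i).
Qed.

Lemma coface_bigcap (I : finType) (A : {set I}) (E : I -> {set cube n}) :
  (forall i, coface (E i) 1) -> coface (\bigcap_(i in A) E i)%SET #|A|.
Proof.
move=> cE; rewrite -sum1_card; apply: (big_ind2 (fun E m => coface E m)) => //.
  exact: cofaceT.
by move=> ? ? ? ?; exact: cofaceI.
Qed.

Definition upper_set (v : cube n) : {set cube n} :=
  [set w : cube n | [forall i, v i ==> w i]]%SET.

Definition weight (v : cube n) : nat := #|[set i | v i]%SET|.

(** This face fixes to 1 the coordinates where [v] is 1. An element of [F (weight v)] placed on it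
    corrects a cube at [v] and leaves the vertices not above [v] alone. *)
Lemma coface_upper_set v : coface (upper_set v) (weight v).
Proof.
right; exists [ffun i => if v i then Some true else None].
  apply/setP => w; rewrite in_face inE; apply: eq_forallb => i.
  by rewrite ffunE; case: (v i) => //; rewrite eqb_id.
apply/subset_leq_card/fintype.subsetP => i.
by rewrite !inE ffunE; case: (v i).
Qed.

End Cofaces.

(** A face is an intersection of coordinate conditions, one per fixed coordinate, and each pulls
    back to a set of codimension at most 1. The hypothesis on [phi] stands in for being a cube
    morphism from here on. *)
Lemma coface_preim m n (phi : cube m -> cube n) (E : {set cube n}) k :
  (forall i b, coface [set v | phi v i == b]%SET 1) ->
  coface E k -> coface (phi @^-1: E)%SET k.
Proof.
move=> phiP [->|[p -> pk]]; first by left; rewrite finset.preimset0.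
pose F i := [set v | phi v i == odflt false (p i)]%SET.
have -> : (phi @^-1: face p = \bigcap_(i in [set i | isSome (p i)]) F i)%SET.
  apply/setP => v; rewrite inE in_face; apply/forallP/bigcapP => [vp i|vp i].
    by move: (vp i); rewrite !inE; case: (p i).
  by move: (vp i); rewrite !inE; case: (p i) => // b /(_ isT).
have [->|[q -> qk]] := coface_bigcap [set i | isSome (p i)]%SET
  (fun i => phiP i (odflt false (p i))); first by left.
by right; exists q => //; exact: leq_trans pk.
Qed.

Section Insertion.
Variables (n : nat) (i : 'I_n.+1).

(** With [b = false] this is convertible to [lower_face], so corners can be handled by the lemmas
    below. *)
Definition insert_coord (b : bool) (w : cube n) : cube n.+1 :=
  [ffun j => if unlift i j is Some k then w k else b].

Definition delete_coord (v : cube n.+1) : cube n := [ffun j => v (lift i j)].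

Lemma insert_coord_at b w : insert_coord b w i = b.
Proof. by rewrite ffunE unlift_none. Qed.

Lemma insert_coord_lift b w j : insert_coord b w (lift i j) = w j.
Proof. by rewrite ffunE liftK. Qed.

Lemma insert_coordK b : cancel (insert_coord b) delete_coord.
Proof. by move=> w; apply/ffunP => j; rewrite ffunE insert_coord_lift. Qed.

Lemma delete_coordK (v : cube n.+1) : insert_coord (v i) (delete_coord v) = v.
Proof.
by apply/ffunP => j; rewrite ffunE; case: unliftP => [k|] ->; rewrite ?ffunE.
Qed.

Lemma insert_coord_coface b j b' :
  coface [set w | insert_coord b w j == b']%SET 1.
Proof.
have [k ->|->] := unliftP i j.
  rewrite (_ : finset _ = [set w : cube n | w k == b']%SET).
    exact: coface_coord.
  by apply/setP => w; rewrite !inE insert_coord_lift.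
have [bb|bb] := eqVneq b b'; last first.
  left; apply/setP => w; rewrite !inE insert_coord_at.
  exact: negbTE.
rewrite (_ : finset _ = [set: cube n]%SET).
  by have [->|[p -> p0]] := cofaceT n; [left|right; exists p => //; exact: leqW].
by apply/setP => w; rewrite !inE insert_coord_at bb eqxx.
Qed.

Lemma delete_coord_coface j b : coface [set v | delete_coord v j == b]%SET 1.
Proof.
rewrite (_ : finset _ = [set v : cube n.+1 | v (lift i j) == b]%SET).
  exact: coface_coord.
by apply/setP => v; rewrite !inE ffunE.
Qed.

Lemma weight_insert_coord b w : weight (insert_coord b w) = (b + weight w)%N.
Proof.
rewrite /weight -!sum1_card !(big_mkcond (fun j => j \in _)) /=.
rewrite (bigD1_ord i) //= inE insert_coord_at.
have -> : (if b then 1 else 0)%N = b :> nat by case: b.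
by congr (_ + _)%N; apply: eq_bigr => j _; rewrite !inE insert_coord_lift.
Qed.

End Insertion.

(** A coordinate of [phi] is an affine form with values in {0,1}. Testing it at 0, at the unit
    vectors and at sums of two of them shows that at most one coefficient is nonzero. So it is
    constant, a coordinate, or the negation of one. *)
Lemma cube_morphism_coface m n (phi : cube m -> cube n) :
  cube_morphism phi -> forall i b, coface [set v | phi v i == b]%SET 1.
Proof.
move=> [h [c hc]] i b.
pose a j : int := (h (delta_mx 0 j) ord0 i)%R.
pose be : int := c ord0 i.
have val v : ((phi v i : nat) : int) = (\sum_(j < m) (v j : nat)%:Z * a j + be)%R.
  have := congr1 (fun M : 'rV[int]_n => M ord0 i) (hc v).
  rewrite !mxE -natz => ->; congr (_ + _)%R.
  rewrite [cube_vec v]matrix_sum_delta big_ord1 raddf_sum summxE.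
  apply: eq_bigr => j _; rewrite mxE /a.
  by case: (v j); rewrite ?scale1r ?scale0r ?raddf0 ?mxE ?mul1r ?mul0r.
pose e j : cube m := [ffun k => k == j].
have val0 : ((phi [ffun=> false] i : nat) : int) = be.
  by rewrite val big1 ?add0r // => j _; rewrite ffunE mul0r.
have val1 j : ((phi (e j) i : nat) : int) = (a j + be)%R.
  rewrite val (bigD1 j) //= ffunE eqxx mul1r big1 ?addr0 // => k kj.
  by rewrite ffunE (negbTE kj) mul0r.
have val2 j l : l != j ->
    ((phi [ffun k => (k == j) || (k == l)] i : nat) : int) = (a j + a l + be)%R.
  move=> lj; rewrite val (bigD1 j) //= (bigD1 l) //= !ffunE !eqxx orbT !mul1r.
  rewrite big1 ?addr0 ?addrA // => k /andP[kj kl].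
  by rewrite ffunE (negbTE kj) (negbTE kl) mul0r.
have [/existsP[j aj]|/existsPn a0] := boolP [exists j, a j != 0%R].
  have al l : l != j -> a l = 0%R.
    move=> lj; move: (val2 _ _ lj) (val1 l) (val1 j) val0 aj.
    do 4 case: (phi _ i) => /=; lia.
  (* The constant term decides the sign: [a j] is 1 when [be] is 0, and -1 when [be] is 1. *)
  have bval v : phi v i = v j (+) phi [ffun=> false] i.
    move: (val v); rewrite (bigD1 j) //= big1 ?addr0 => [|l lj]; last first.
      by rewrite al // mulr0.
    move: (val1 j) val0 aj.
    case: (phi v i); case: (v j); do 2 case: (phi _ i) => /=; lia.
  rewrite (_ : finset _ =
      [set v : cube m | v j == b (+) phi [ffun=> false] i]%SET).
    exact: coface_coord.
  by apply/setP => v; rewrite !inE bval; case: (v j); case: b; case: (phi _ i).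
have cst v : phi v i = phi [ffun=> false] i.
  move: (val v) val0; rewrite big1 => [|l _]; last first.
    by move: (a0 l); rewrite negbK => /eqP ->; rewrite mulr0.
  by case: (phi _ i); case: (phi _ i) => //=; lia.
have [bb|bb] := eqVneq (phi [ffun=> false] i) b; last first.
  by left; apply/setP => w; rewrite !inE cst; exact: negbTE.
rewrite (_ : finset _ = [set: cube m]%SET).
  by have [->|[p -> p0]] := cofaceT m; [left|right; exists p => //; exact: leqW].
by apply/setP => w; rewrite !inE cst bb eqxx.
Qed.

(** * Cubes of a filtered group *)

(** Unlike a filtration, this need not start with the whole group, so it is stable under the index
    shift on which the inductions over the dimension rest. *)
Definition prefiltration (G : groupType) (F : nat -> subgroup G) : Prop :=
  (forall i, (F i.+1 : set G) `<=` F i) /\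
  (forall i j x y, (F i : set G) x -> (F j : set G) y ->
     (F (i + j)%N : set G) [~ x, y]).

Lemma fun_mulE (I : Type) (G : groupType) (f g : I -> G) i :
  (f * g) i = f i * g i.
Proof. by []. Qed.

Lemma fun_invE (I : Type) (G : groupType) (f : I -> G) i : f^-1 i = (f i)^-1.
Proof. by []. Qed.

Definition filtration_shift (G : groupType) (F : nat -> subgroup G) i := F i.+1.

Section Cubes.
Variable G : groupType.
Implicit Types (F : nat -> subgroup G) (g h : G).

Lemma filtration_pre F : filtration F -> prefiltration F.
Proof.
move=> [_ _ dF cF]; split=> // i j x y Fx Fy; apply: cF.
by apply: sub_generated; exists x => //; exists y.
Qed.

Lemma prefiltration_shift F : prefiltration F -> prefiltration (filtration_shift F).
Proof.
move=> [dF cF]; split=> [i|i j x y Fx Fy]; first exact: dF.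
by apply: dF; rewrite -addSn -addnS; exact: cF.
Qed.

Lemma prefiltration_le F i j :
  prefiltration F -> (i <= j)%N -> (F j : set G) `<=` F i.
Proof.
move=> [dF _]; elim: j => [|j IH]; first by rewrite leqn0 => /eqP ->.
by rewrite leq_eqVlt => /orP[/eqP ->//|/IH ji x /dF /ji].
Qed.

Lemma prefiltration_normal F i x y : prefiltration F ->
  (F 0 : set G) x -> (F i : set G) y -> (F i : set G) (x * y * x^-1).
Proof.
move=> [_ cF] Fx Fy.
have -> : x * y * x^-1 = [~ x^-1, y^-1] * y.
  by rewrite (commgCV x y) -!mulgA mulgV mulg1.
by apply: subgM => //; apply: (cF 0); exact: subgV.
Qed.

Definition set_elt n (E : {set cube n}) g : cube n -> G :=
  fun v => if v \in E then g else 1.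

Lemma group_cubes_is_subgroup F n : is_subgroup (group_cubes F n).
Proof. exact: generated_is_subgroup. Qed.

Definition cubes_subgroup F n := Subgroup (group_cubes_is_subgroup F n).

Lemma group_cubes1 F n : group_cubes F n 1.
Proof. exact: (subg1 (cubes_subgroup F n)). Qed.

Lemma group_cubesM F n (c d : cube n -> G) :
  group_cubes F n c -> group_cubes F n d -> group_cubes F n (c * d).
Proof. exact: (@subgM _ (cubes_subgroup F n)). Qed.

Lemma group_cubesV F n (c : cube n -> G) :
  group_cubes F n c -> group_cubes F n c^-1.
Proof. exact: (@subgV _ (cubes_subgroup F n)). Qed.

Lemma set_elt_cube F n (E : {set cube n}) m g : prefiltration F ->
  coface E m -> (F m : set G) g -> group_cubes F n (set_elt E g).
Proof.
move=> pF [->|[p -> pm]] Fg.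
  rewrite (_ : set_elt _ _ = 1); first exact: group_cubes1.
  by apply/funext => v; rewrite /set_elt inE.
apply: sub_generated; exists p, g; split=> //.
exact: prefiltration_le pm _ Fg.
Qed.

Lemma group_cubes_ind F n (A : set (cube n -> G)) : is_subgroup A ->
  (forall (E : {set cube n}) m g, coface E m -> (F m : set G) g ->
     A (set_elt E g)) ->
  group_cubes F n `<=` A.
Proof.
move=> sA genA; apply: (@generated_sub _ _ (Subgroup sA)) => _ [p [g [Fg ->]]].
by apply: genA Fg; right; exists p.
Qed.

Lemma group_cubes_comp F m n (phi : cube m -> cube n) c :
  prefiltration F -> (forall i b, coface [set v | phi v i == b]%SET 1) ->
  group_cubes F n c -> group_cubes F m (c \o phi).
Proof.
move=> pF phiP; move: c; apply: (@group_cubes_ind _ _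
  [set c : cube n -> G | group_cubes F m (c \o phi)]).
  apply: mk_subgroup => /= [|c d|c]; first exact: group_cubes1.
    exact: group_cubesM.
  exact: group_cubesV.
move=> E k g cE Fg /=.
rewrite (_ : _ \o _ = set_elt (phi @^-1: E)%SET g).
  by apply: set_elt_cube Fg => //; exact: coface_preim.
by apply/funext => v; rewrite /set_elt /= inE.
Qed.

Lemma group_cubes_val F n c v : prefiltration F ->
  group_cubes F n c -> (F 0 : set G) (c v).
Proof.
move=> pF; move: c; apply: (@group_cubes_ind _ _
  [set c : cube n -> G | (F 0 : set G) (c v)]).
  apply: mk_subgroup => /= [|c d|c]; first exact: subg1.
    exact: subgM.
  exact: subgV.
move=> E k g _ Fg /=; rewrite /set_elt; case: ifP => _; last exact: subg1.
exact: prefiltration_le Fg.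
Qed.

(** On generators, conjugating [h] on [E'] by [g] on [E] yields a commutator on the intersection of
    [E] and [E'], times [h] on [E']. The commutator has index [m + m' + 1], which is what the
    shifted filtration asks for there. *)
Lemma group_cubes_normal F n c d : prefiltration F ->
  group_cubes F n c -> group_cubes (filtration_shift F) n d ->
  group_cubes (filtration_shift F) n (c * d * c^-1).
Proof.
move=> pF.
have gen (E : {set cube n}) m g d' : coface E m -> (F m : set G) g ->
    group_cubes (filtration_shift F) n d' ->
    group_cubes (filtration_shift F) n (set_elt E g * d' * (set_elt E g)^-1).
  move=> cE Fg; move: d'; apply: (@group_cubes_ind _ _ [set d' : cube n -> G |
    group_cubes (filtration_shift F) n (set_elt E g * d' * (set_elt E g)^-1)]).
    apply: mk_subgroup => /= [|x y|x].
    - by rewrite mulg1 mulgV; exact: group_cubes1.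
    - by move=> cx /(group_cubesM cx); rewrite !mulgA mulgVK.
    - by move=> /group_cubesV; rewrite !invgM invgK !mulgA.
  move=> E' m' h cE' Fh /=.
  rewrite (_ : _ * _ * _ =
      set_elt (E :&: E')%SET [~ g^-1, h^-1] * set_elt E' h).
    apply: group_cubesM; last exact: set_elt_cube (prefiltration_shift pF) cE' Fh.
    apply: (set_elt_cube (prefiltration_shift pF) (cofaceI cE cE')).
    by rewrite /filtration_shift -addnS; apply: pF.2; exact: subgV.
  apply/funext => v; rewrite !(fun_mulE, fun_invE) /set_elt inE.
  case: (v \in E); case: (v \in E') => /=; rewrite ?mul1g ?invg1 ?mulg1 ?mulgV //.
  by rewrite (commgCV g h) -!mulgA mulgV mulg1.
have set_eltV (E : {set cube n}) g : (set_elt E g)^-1 = set_elt E g^-1.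
  apply/funext => v; rewrite fun_invE /set_elt.
  by case: ifP => // _; rewrite invg1.
(* Conjugation by [c] and by its inverse are treated together, so that the admissible [c] are closed
   under inversion. *)
move=> cc cd; suff : forall d, group_cubes (filtration_shift F) n d ->
    group_cubes (filtration_shift F) n (c * d * c^-1) /\
    group_cubes (filtration_shift F) n (c^-1 * d * c).
  by move=> /(_ d cd)[].
move: c cc {d cd}; apply: (@group_cubes_ind _ _ [set c : cube n -> G |
    forall d, group_cubes (filtration_shift F) n d ->
    group_cubes (filtration_shift F) n (c * d * c^-1) /\
    group_cubes (filtration_shift F) n (c^-1 * d * c)]).
  apply: mk_subgroup => /= [d dd|x y hx hy d dd|x hx d dd].
  - by rewrite invg1 !(mulg1, mul1g).
  - rewrite invgM; split.
      by have [/hx[+ _] _] := hy _ dd; rewrite !mulgA.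
    by have [_ /hy[_]] := hx _ dd; rewrite !mulgA.
  - by rewrite invgK; have [] := hx _ dd.
move=> E m g cE Fg d dd /=; split; first exact: gen cE Fg dd.
by have := gen _ _ _ _ cE (subgV Fg) dd; rewrite -set_eltV invgK.
Qed.

Lemma group_cubes_face F n b c : prefiltration F ->
  group_cubes F n.+1 c -> group_cubes F n (c \o insert_coord ord0 b).
Proof.
by move=> pF; apply: group_cubes_comp => // i b'; exact: insert_coord_coface.
Qed.

(** A generator whose face leaves the first coordinate free has equal lower and upper faces. If the
    coordinate is fixed, the quotient is a generator on a face of codimension one less, hence a cube
    of the shifted filtration. Products and inverses are handled by normality. *)
Lemma group_cubesS_diff F n c : prefiltration F -> group_cubes F n.+1 c ->
  group_cubes (filtration_shift F) n
    ((c \o insert_coord ord0 false)^-1 * (c \o insert_coord ord0 true)).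
Proof.
move=> pF; pose i0 := @insert_coord n ord0 false; pose i1 := @insert_coord n ord0 true.
suff : group_cubes F n.+1 `<=` [set c : cube n.+1 -> G | group_cubes F n (c \o i0) /\
    group_cubes (filtration_shift F) n ((c \o i0)^-1 * (c \o i1))] by move=> + cc => /(_ c cc)[].
apply: group_cubes_ind => [|E m g cE Fg] /=.
  apply: mk_subgroup => [|x y [x0 x1] [y0 y1]|x [x0 x1]].
  - split; first exact: group_cubes1.
    by rewrite (_ : _ * _ = 1) ?mulVg//; exact: group_cubes1.
  - split; first exact: group_cubesM.
    (* The quotient for [x * y] is the quotient for [x], conjugated by the inverse of the lower face
       of [y], times the quotient for [y]. *)
    rewrite -[_ * _](_ : ((y \o i0)^-1 * ((x \o i0)^-1 * (x \o i1)) * (y \o i0)^-1^-1) *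
      ((y \o i0)^-1 * (y \o i1)) = _).
      by apply: group_cubesM => //; apply: group_cubes_normal => //; exact: group_cubesV.
    apply/funext => v; rewrite !(fun_mulE, fun_invE) /=.
    by rewrite !(fun_mulE, fun_invE) invgK invgM !mulgA mulgK.
  - split; first exact: group_cubesV.
    have := group_cubes_normal pF x0 (group_cubesV x1).
    congr (group_cubes _ _ _); apply/funext => v.
    by rewrite !(fun_mulE, fun_invE) /= !(fun_mulE, fun_invE) invgM !invgK !mulgA mulgK.
split.
  rewrite (_ : _ \o _ = set_elt (i0 @^-1: E)%SET g).
    by apply: set_elt_cube Fg => //; apply: coface_preim cE; exact: insert_coord_coface.
  by apply/funext => v; rewrite /set_elt /= inE.
have [E0|[p E_p pm]] := cE.
  rewrite (_ : _ * _ = 1); first exact: group_cubes1.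
  by apply/funext => v; rewrite fun_mulE fun_invE /= /set_elt E0 !inE mulVg.
pose q := [ffun j => p (lift ord0 j)] : face_spec n.
have Eq b v : (insert_coord ord0 b v \in E) =
    (if p ord0 is Some b' then b == b' else true) && (v \in face q).
  rewrite E_p !in_face; apply/forallP/andP => [pv|[p0 /forallP qv] j].
    split; first by have := pv ord0; rewrite insert_coord_at.
    by apply/forallP => j; rewrite ffunE; have := pv (lift ord0 j); rewrite insert_coord_lift.
  have [k ->|->] := unliftP ord0 j; last by rewrite insert_coord_at.
  by rewrite insert_coord_lift; have := qv k; rewrite ffunE.
have cp : codim p = (isSome (p ord0) + codim q)%N.
  rewrite /codim -!sum1_card !(big_mkcond (fun j => j \in _)) /= big_ord_recl inE.
  have -> : (if isSome (p ord0) then 1 else 0)%N = isSome (p ord0) by case: (p ord0).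
  by congr (_ + _)%N; apply: eq_bigr => j _; rewrite !inE ffunE.
case p0 : (p ord0) => [b|]; last first.
  rewrite (_ : _ * _ = 1); first exact: group_cubes1.
  by apply/funext => v; rewrite fun_mulE fun_invE /= /set_elt !Eq p0 mulVg.
(* For [b = true] only the upper face carries [g]; for [b = false] only the lower one does, and it
   enters inverted. *)
rewrite (_ : _ * _ = set_elt (face q) (if b then g else g^-1)).
  apply: (set_elt_cube (m := codim q) (prefiltration_shift pF)).
    by right; exists q.
  have : (F (codim q).+1 : set G) g.
    by apply: prefiltration_le Fg => //; rewrite p0 add1n in cp; rewrite -cp.
  by case: b {p0} => //; exact: subgV.
apply/funext => v; rewrite fun_mulE fun_invE /= /set_elt !Eq p0.
by case: b {p0}; case: (v \in face q) => /=; rewrite ?invg1 ?mulg1 ?mul1g.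
Qed.

Definition le_cube n (w v : cube n) : Prop := forall i, w i -> v i.

(* With [d0], [d1] the lower and upper faces of [d], the value of [d1] is that of
   [d0] times that of [d0^-1 * d1], a cube of the shifted filtration; the element
   of K given by [d0] is moved to the right by conjugation. *)
Lemma cube_top F n d (v : cube n) (K : subgroup G) : prefiltration F ->
  group_cubes F n d ->
  (forall w, le_cube w v -> w <> v -> (K : set G) (d w)) ->
  exists2 g, (F (weight v) : set G) g & (K : set G) (g^-1 * d v).
Proof.
elim: n F d v => [|n IH] F d v pF cd Kd.
  exists (d v); last by rewrite mulVg; exact: subg1.
  rewrite (_ : weight v = 0%N); first exact: group_cubes_val cd.
  by apply/eqP; rewrite cards_eq0; apply/eqP/setP => -[].
pose v' := delete_coord ord0 v.
have vE : v = insert_coord ord0 (v ord0) v' by rewrite delete_coordK.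
have wv (b : bool) w : b ==> v ord0 -> le_cube w v' -> le_cube (insert_coord ord0 b w) v.
  move=> bv wv' j; have [k ->|->] := unliftP ord0 j.
    by rewrite insert_coord_lift => /wv'; rewrite ffunE.
  by rewrite insert_coord_at; move: bv; case: b; case: (v ord0).
have wNv b w : b <> v ord0 \/ w <> v' -> insert_coord ord0 b w <> v.
  move=> + e; rewrite /v' -e insert_coord_at insert_coordK.
  by case.
rewrite {1 2}vE weight_insert_coord.
pose d0 := d \o insert_coord ord0 false.
have cd0 : group_cubes F n d0 by exact: group_cubes_face.
case v0 : (v ord0); last first.
  apply: (IH F d0) => // w wv' wNv'; apply: Kd; first by apply: wv.
  by apply: wNv; right.
(* As the first coordinate of [v] is 1, all these vertices of the lower face, [v'] included, lie
   strictly below [v]. *)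
have Kd0 w : le_cube w v' -> (K : set G) (d0 w).
  move=> wv'; apply: Kd; first exact: wv.
  by apply: wNv; left; rewrite v0.
have Kd1 w : le_cube w v' -> w <> v' ->
    (K : set G) ((d0^-1 * (d \o insert_coord ord0 true)) w).
  move=> wv' wNv'; apply: subgM; first by apply: subgV; exact: Kd0.
  by apply: Kd; [apply: wv; rewrite ?v0|apply: wNv; right].
have [g Fg Kg] := IH _ _ v' (prefiltration_shift pF) (group_cubesS_diff pF cd) Kd1.
exists (d0 v' * g * (d0 v')^-1).
  exact: (prefiltration_normal (i := (weight v').+1) pF (group_cubes_val v' pF cd0) Fg).
have -> : (d0 v' * g * (d0 v')^-1)^-1 * d (insert_coord ord0 true v') =
   d0 v' * (g^-1 * ((d0 v')^-1 * d (insert_coord ord0 true v'))).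
  by rewrite !invgM invgK !mulgA.
by apply: subgM => //; exact: Kd0.
Qed.

End Cubes.

(** * Topological groups and coset spaces *)

Section CompactSets.
Variable T : topologicalType.

(** If no finite subfamily covered [A], the complements in [A] of finite unions would generate a
    proper filter, and a cluster point of it in [A] could lie in no [O i]. *)
Lemma compact_cover_seq (I : Type) (A : set T) (O : I -> set T) :
  compact A -> (forall i, open (O i)) -> A `<=` \bigcup_i O i ->
  exists s : seq I, A `<=` \big[setU/set0]_(i <- s) O i.
Proof.
move=> cA oO AO; apply: contrapT => nex.
pose F := filter_from [set: seq I]
  (fun s => A `\` \big[setU/set0]_(i <- s) O i).
have FF : ProperFilter F.
  apply: filter_from_proper.
    apply: filter_from_filter; first by exists [::].
    move=> s t _ _; exists (s ++ t) => // x [Ax]; rewrite big_cat /= => nst.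
    by split; split=> // ?; apply: nst; [left|right].
  move=> s _; apply: contrapT => ns; apply: nex; exists s => x Ax.
  by apply: contrapT => nx; apply: ns; exists x.
have [|x [Ax clx]] := cA F FF.
  by exists [::] => // x [].
have [i _ Oix] := AO _ Ax.
have [|y [[_ +] Oiy]] := clx (A `\` O i) (O i) _ (open_nbhs_nbhs (conj (oO i) Oix)).
  by exists [:: i] => //; rewrite big_seq1.
by apply.
Qed.

Lemma compact_set_val (A K : set T) :
  K `<=` A -> compact K -> compact (set_val @^-1` K : set (set_type A)).
Proof.
move=> KA cK F FF FK.
have [|p [Kp clp]] := cK (set_val @ F) _; first exact: FK.
exists (exist _ p (mem_set (KA _ Kp))); split=> // B V FB [_ [[W oW <-] Wp WV]].
have : (set_val @ F) (set_val @` B).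
  have BB : B `<=` set_val @^-1` (set_val @` B) by move=> y By; exists y.
  exact: filterS BB FB.
move=> /clp/(_ (open_nbhs_nbhs (conj oW Wp)))[_ [[y By <-] Wy]].
by exists y; split=> //; exact: WV.
Qed.

Lemma second_countable_dense (x0 : T) : @second_countable T ->
  exists d : nat -> T, forall O, open O -> O !=set0 -> exists m, O (d m).
Proof.
move=> [B /countable_injP[f finj] [oB Bbasis]].
pose P m x := exists2 U, B U & f U = m /\ U x.
(* A point is chosen in the basic set numbered [m]; [x0] serves for numbers that name no nonempty
   basic set. *)
exists (fun m => xget x0 (P m)) => O oO [x Ox].
have [U [BU Ux] UO] := Bbasis x O (open_nbhs_nbhs (conj oO Ox)).
have [|V BV [fVU Vd]] := @xgetPex _ x0 (P (f U)); first by exists x, U.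
have VU : V = U by apply: finj => //; exact: mem_set.
by exists (f U); apply: UO; move: Vd; rewrite VU.
Qed.

(** Otherwise there are open sets [u m] meeting [Y] such that the closure of each lies in the
    previous one and avoids [C m]. A cluster point of their traces on [Y] is a point of [Y] outside
    every [C m]. *)
Lemma compact_baire (Y : set T) (C : nat -> set T) :
  hausdorff_space T -> compact [set: T] -> closed Y -> Y !=set0 ->
  (forall m, closed (C m)) -> Y `<=` \bigcup_m C m ->
  exists m U, [/\ open U, U `&` Y !=set0 & U `&` Y `<=` C m].
Proof.
move=> hT cT cY Y0 cC YC; apply: contrapT => nint.
(* The conditions on [U] are premises under the existential, so that choice gives a total function
   to iterate. *)
have step (mU : nat * set T) : exists V,
    open mU.2 -> mU.2 `&` Y !=set0 -> [/\ open V, V `&` Y !=set0,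
      closure V `<=` mU.2 & closure V `<=` ~` C mU.1].
  case: mU => m U /=.
  have [[oU UY]|nU] := pselect (open U /\ U `&` Y !=set0); last first.
    by exists set0 => oU UY; case: nU.
  have [y [[Uy Yy] nCy]] : exists y, (U `&` Y) y /\ ~ C m y.
    apply: contrapT => ny; apply: nint; exists m, U; split=> // y UYy.
    by apply: contrapT => nC; apply: ny; exists y.
  have nb : nbhs y (U `&` ~` C m).
    by apply: open_nbhs_nbhs; split=> //; apply: openI => //; exact: closed_openC.
  have [V yV VU] := @compact_regular _ y setT hT cT filterT _ nb.
  exists V° => _ _; have clV : closure V° `<=` U `&` ~` C m.
    by apply: subset_trans VU; apply: closureS; exact: interior_subset.
  split; [exact: open_interior|by exists y|by move=> z /clV[]|by move=> z /clV[]].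
have [f fP] := choice step.
pose fix u m := if m is m'.+1 then f (m', u m') else setT.
have uP m : open (u m) /\ u m `&` Y !=set0.
  elim: m => [|m [om um]] /=; first by rewrite setTI; split=> //; exact: openT.
  by have [] := fP (m, u m) om um.
have uS m : closure (u m.+1) `<=` u m /\ closure (u m.+1) `<=` ~` C m.
  by have [om um] := uP m; have [] := fP (m, u m) om um.
have u_le m n : (m <= n)%N -> u n `<=` u m.
  elim: n => [|n IH]; first by rewrite leqn0 => /eqP ->.
  rewrite leq_eqVlt => /orP[/eqP ->//|/IH mn].
  by apply: subset_trans mn; apply: subset_trans (uS n).1; exact: subset_closure.
pose F := filter_from [set: nat] (fun m => u m `&` Y).
have FF : ProperFilter F.
  apply: filter_from_proper; last by move=> m _; exact: (uP m).2.
  apply: filter_from_filter; first by exists 0%N.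
  move=> m n _ _; exists (maxn m n) => // x [ux Yx].
  by split; split=> //; apply: u_le ux; rewrite ?leq_maxl ?leq_maxr.
have [x [_]] := cT F FF filterT; rewrite clusterE => clx.
have Yx : Y x.
  by apply: cY; apply: clx; exists 0%N => // z [].
have [m _ Cx] := YC _ Yx.
by apply: (uS m).2 Cx; apply: clx; exists m.+1 => // z [].
Qed.

End CompactSets.

Lemma ptws_continuous (I : Type) (S T : topologicalType)
    (f : S -> {ptws I -> T}) :
  (forall i, continuous (fun s => f s i)) -> continuous f.
Proof.
move=> cf s; apply/cvg_sup => i U [_ [[W oW <-] Wfs WU]].
by apply: filterS WU _; apply: (cf i); exact: open_nbhs_nbhs.
Qed.

Lemma ptws_eval_continuous (I : eqType) (T : topologicalType) (i : I) :
  continuous (fun f : {ptws I -> T} => f i).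
Proof. exact: (@proj_continuous I (fun=> T) i). Qed.

Lemma ptws_hausdorff (I : eqType) (T : topologicalType) :
  hausdorff_space T -> hausdorff_space {ptws I -> T}.
Proof. by move=> hT; exact: (@hausdorff_product I (fun=> T)). Qed.

(** The inverse of a chart at 1 carries a compact box around the image of 1 to a compact
    neighbourhood of 1. *)
Lemma lie_group_locally_compact (R : realType) (G : topologicalGroupType) :
  lie_group R G -> exists2 N : set G, compact N & nbhs 1 N.
Proof.
move=> [_ _ [d [A [[Ach Acov _] _ _]]]].
have [c Ac c1] : (\bigcup_(a in A) chart_dom a) (1 : G) by rewrite Acov.
have [odom oim invK mapC invC] := Ach _ Ac.
set x := chart_map c 1.
have imx : (chart_map c @` chart_dom c) x by exists 1.
have := open_nbhs_nbhs (conj oim imx) => -[P Px PO].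
have /= Pe i : exists e : R, (0 < e)%R /\ closed_ball (x ord0 i) e `<=` P ord0 i.
  have /nbhs_closedballP[e] := Px ord0 i.
  by exists (e%:num)%R.
have [e eP] := choice Pe.
pose B := [set v : 'rV[R]_d | forall i, closed_ball (x ord0 i) (e i) (v ord0 i)].
have cB : compact B.
  apply: (@rV_compact _ d (fun i => closed_ball (x ord0 i) (e i))) => i.
  exact: closed_ballR_compact (eP i).1.
have BO : B `<=` chart_map c @` chart_dom c.
  move=> v Bv; apply: PO => i j; rewrite (ord1 i); apply: (eP j).2; exact: Bv.
exists (chart_inv c @` B).
  apply: continuous_compact cB; apply: continuous_in_subspaceT => v.
  by rewrite inE => /BO; exact: invC.
have : nbhs x B.
  exists (fun i j => closed_ball (x i j) (e j)).
    move=> i j; rewrite (ord1 i).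
    apply: filterS (nbhsx_ballx _ _ (eP j).1); exact: subset_closed_ball.
  by move=> v /= Bv i; exact: Bv.
move=> /(mapC _ c1) /= nB.
apply: filterS (filterI (open_nbhs_nbhs (conj odom c1)) nB) => y [domy By].
by exists (chart_map c y) => //; exact: invK.
Qed.

Section TopologicalGroups.
Variable G : topologicalGroupType.

Lemma continuous_mulg (T : topologicalType) (f g : T -> G) :
  continuous f -> continuous g -> continuous (fun t => f t * g t).
Proof.
move=> cf cg t.
apply: (@continuous2_cvg _ G G G (nbhs t) _ f g (fun x y => x * y) (f t) (g t)).
- exact: (@mulg_continuous G (f t, g t)).
- exact: cf.
- exact: cg.
Qed.

Lemma continuous_invg (T : topologicalType) (f : T -> G) :
  continuous f -> continuous (fun t => (f t)^-1).
Proof. by move=> cf t; apply: continuous_comp; [exact: cf|exact: invg_continuous]. Qed.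

Lemma mulg_left_continuous (a : G) : continuous ( *%g a).
Proof. by apply: continuous_mulg; [exact: cst_continuous|move=> ?; exact: cvg_id]. Qed.

Lemma mulg_right_continuous (a : G) : continuous ( *%g^~ a).
Proof. by apply: continuous_mulg; [move=> ?; exact: cvg_id|exact: cst_continuous]. Qed.

Lemma left_div_continuous : continuous (fun z : G * G => z.1^-1 * z.2).
Proof.
by apply: continuous_mulg; [apply: continuous_invg|]; move=> z; [exact: cvg_fst|exact: cvg_snd].
Qed.

(** Let [U] meet [K] only in 1. Two distinct points [y], [z] of [K] close enough to a limit point
    [x] outside [K] would have [y^-1 * z] in [U], forcing [y = z]. *)
Lemma discrete_subgroup_closed (K : subgroup G) :
  hausdorff_space G -> discrete_subset (K : set G) -> closed (K : set G).
Proof.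
move=> hG dK x clx; apply: contrapT => nKx.
have [U oU UE] := dK 1.
have U1 : U 1 by have : (set_val @^-1` U) (1 : set_type K) by rewrite UE.
have UK y : U y -> (K : set G) y -> y = 1.
  move=> Uy Ky; have : (set_val @^-1` U) (exist _ y (mem_set Ky) : set_type K) by [].
  by rewrite UE => /(congr1 set_val).
have /left_div_continuous : nbhs ((x, x).1^-1 * (x, x).2) U.
  by rewrite mulVg; exact: open_nbhs_nbhs.
move=> [[A B] /= [nA nB] AB].
have [y [Ky [Ay By]]] := clx _ (filterI nA nB).
have yx : y <> x by move=> e; rewrite -e in nKx.
have nx : nbhs x (~` [set y]).
  apply: open_nbhs_nbhs; split; last by move=> /esym.
  apply: closed_openC; apply: accessible_closed_set1.
  exact: hausdorff_accessible.
have [z [Kz [Bz zy]]] := clx _ (filterI nB nx).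
apply: zy; have := UK (y^-1 * z) (AB (y, z) (conj Ay Bz)) (subgM (subgV Ky) Kz).
by move=> /(congr1 ( *%g y)); rewrite mulVKg mulg1.
Qed.

(** The translates of [N] by a dense sequence cover: the points [y] with [y^-1 * x] in the interior
    of [N] form a nonempty open set. *)
Lemma group_locally_compact_sigma (N : set G) : @second_countable G ->
  compact N -> nbhs 1 N ->
  exists C : nat -> set G, (forall m, compact (C m)) /\ \bigcup_m C m = setT.
Proof.
move=> /(second_countable_dense 1)[d dP] cN nN.
exists (fun m => *%g (d m) @` N); split=> [m|].
  apply: continuous_compact => //; apply: continuous_subspaceT.
  exact: mulg_left_continuous.
apply/seteqP; split=> // x _.
have c : continuous (fun y : G => y^-1 * x).
  apply: continuous_mulg; last exact: cst_continuous.
  by apply: continuous_invg => ?; exact: cvg_id.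
have [||m Nm] := dP ((fun y : G => y^-1 * x) @^-1` N°).
- by move/continuousP: c; apply; exact: open_interior.
- by exists x; rewrite /= mulVg; exact: nN.
exists m => //; exists ((d m)^-1 * x); last by rewrite mulVKg.
exact: interior_subset Nm.
Qed.

End TopologicalGroups.

Lemma set_type_second_countable (T : topologicalType) (A : set T) :
  @second_countable T -> @second_countable (set_type A).
Proof.
move=> [B cB [oB bB]]; exists [set set_val @^-1` U | U in B].
  by apply: sub_countable cB; exact: card_image_le.
split=> [_ [U BU <-]|x V [_ [[W oW <-] Wx WV]]]; first by exists U => //; exact: oB.
have [U [BU Ux] UW] := bB (set_val x) W (open_nbhs_nbhs (conj oW Wx)).
by exists (set_val @^-1` U) => [|y Uy]; [split=> //; exists U|apply: WV; exact: UW].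
Qed.

Section CosetSpaces.
Variables (G : topologicalGroupType) (K : subgroup G).
Let pr := coset_proj K.

Lemma coset_projP x y : pr x = pr y <-> (K : set G) (x^-1 * y).
Proof.
split=> [/(@eqmodP _ (left_coset_equiv_rel K))|Kxy].
  by rewrite /= /left_coset_rel => /set_mem.
by apply/(@eqmodP _ (left_coset_equiv_rel K)); rewrite /= /left_coset_rel; exact: mem_set.
Qed.

Lemma coset_proj_surj z : exists x, pr x = z.
Proof. by exists (repr z); exact: reprK. Qed.

Lemma coset_proj_continuous : continuous pr.
Proof. exact: pi_continuous. Qed.

Lemma coset_proj_open (A : set G) : open A -> open (pr @` A).
Proof.
move=> oA; rewrite /open /= /quotient_open.
have -> : \pi_(coset_space K)%qT @^-1` (pr @` A) =
    \bigcup_(a in (K : set G)) ( *%g^~ a @^-1` A).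
  apply/seteqP; split=> [x [y Ay /coset_projP Kyx]|x [a Ka Aa]].
    exists (y^-1 * x)^-1; first exact: subgV.
    by rewrite /= invgM invgK mulVKg.
  by exists (x * a) => //; apply/coset_projP; rewrite invgM mulgVK; exact: subgV.
apply: bigcup_open => a _; move/continuousP: (@mulg_right_continuous G a); exact.
Qed.

(** If [x^-1 * y] is outside the closed set [K], so is [a^-1 * b] for [a] near [x] and [b] near [y];
    the images of these neighbourhoods are then disjoint. *)
Lemma coset_space_hausdorff : closed (K : set G) -> hausdorff_space (coset_space K).
Proof.
move=> cK p q; have [x <-] := coset_proj_surj p; have [y <-] := coset_proj_surj q.
move=> clu; apply/coset_projP; apply: contrapT => nK.
have /left_div_continuous : nbhs ((x, y).1^-1 * (x, y).2) (~` (K : set G)).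
  by apply: open_nbhs_nbhs; split=> //; exact: closed_openC.
move=> [[A B] /= [nA nB] AB].
have prnb z (C : set G) : nbhs z C -> nbhs (pr z) (pr @` C°).
  move=> nC; apply: open_nbhs_nbhs; split; last by exists z.
  by apply: coset_proj_open; exact: open_interior.
have [_ [[a Aa <-] [b Bb ba]]] := clu _ _ (prnb _ _ nA) (prnb _ _ nB).
apply: (AB (a, b)); first by split; [exact: interior_subset Aa|exact: interior_subset Bb].
exact/coset_projP.
Qed.

Lemma coset_space_second_countable :
  @second_countable G -> @second_countable (coset_space K).
Proof.
move=> [B cB [oB bB]]; exists [set pr @` U | U in B].
  by apply: sub_countable cB; exact: card_image_le.
split=> [_ [U BU <-]|p V]; first by apply: coset_proj_open; exact: oB.
have [x <-] := coset_proj_surj p => nV.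
have [U [BU Ux] UW] := bB x _ (coset_proj_continuous nV).
exists (pr @` U) => [|_ [y Uy <-]]; last exact: UW.
by split; [exists U|exists x].
Qed.

End CosetSpaces.

(** * Cocompactness through compact sets of coset representatives *)

Section Cocompact.
Variables (G : topologicalGroupType) (Gamma H : subgroup G).

(** Finitely many translates of the interior of [N] by elements of [H] have images covering the
    quotient. Intersecting the translates of [N] with the closed [H] keeps them compact. *)
Lemma cocompact_lift (N : set G) : compact N -> nbhs 1 N -> closed (H : set G) ->
  cocompact (trace_subgroup Gamma H) ->
  exists D : set G, [/\ compact D, D `<=` H & forall x, (H : set G) x ->
    exists2 a, D a & (Gamma : set G) (a^-1 * x)].
Proof.
move=> cN nN cH [cX _ _].
pose pr := coset_proj (trace_subgroup Gamma H).
pose O (g : set_type H) := pr @` (set_val @^-1` ((fun y => (set_val g)^-1 * y) @^-1` N°)).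
have oO g : open (O g).
  apply: coset_proj_open; move/continuousP: (@initial_continuous _ _ (set_val : set_type H -> G)); apply.
  by move/continuousP: (@mulg_left_continuous G (set_val g)^-1); apply; exact: open_interior.
have [|s sO] := compact_cover_seq cX oO.
  move=> p _; have [g <-] := coset_proj_surj p; exists g => //; exists g => //=.
  by rewrite mulVg.
exists (\big[setU/set0]_(g <- s) (( *%g (set_val g) @` N) `&` H)); split.
- apply: bigsetU_compact => g _; apply: compact_closedI => //.
  apply: continuous_compact => //; apply: continuous_subspaceT.
  exact: mulg_left_continuous.
- by elim/big_ind : _ => [|A B AH BH x [/AH|/BH]|g _ x []].
move=> x Hx; have := sO (pr (exist _ x (mem_set Hx))) I.
rewrite -!bigcup_seq => -[g gs [y Ny /coset_projP Kyx]].
exists (set_val y) => //; exists g => //; split; last exact/set_mem/(svalP y).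
by exists ((set_val g)^-1 * set_val y); [exact: interior_subset Ny|rewrite mulVKg].
Qed.

Lemma cocompact_of_lift (D : set G) : hausdorff_space G -> @second_countable G ->
  closed (Gamma : set G) ->
  compact D -> D `<=` H -> (forall x, (H : set G) x ->
    exists2 a, D a & (Gamma : set G) (a^-1 * x)) ->
  cocompact (trace_subgroup Gamma H).
Proof.
move=> hG sG cG cD DH HD; split.
- pose pr := coset_proj (trace_subgroup Gamma H).
  have -> : [set: coset_space (trace_subgroup Gamma H)] = pr @` (set_val @^-1` D).
    apply/seteqP; split=> // p _; have [x <-] := coset_proj_surj p.
    have [a Da Ga] := HD _ (set_mem (svalP x)).
    exists (exist _ a (mem_set (DH _ Da))) => //.
    exact/coset_projP.
  apply: continuous_compact; last exact: compact_set_val.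
  by apply: continuous_subspaceT; exact: coset_proj_continuous.
- apply: coset_space_hausdorff.
  have /continuous_closedP := @initial_continuous _ _ (set_val : set_type H -> G).
  by move=> /(_ _ cG).
- by apply: coset_space_second_countable; exact: set_type_second_countable.
Qed.

End Cocompact.

(** * The nilspace structure of a coset space *)

Section CosetNilspace.
Variables (G : topologicalGroupType) (F : nat -> subgroup G) (Gamma : subgroup G).
Hypothesis pF : prefiltration F.
Let pr := coset_proj Gamma.

(* The corner is lifted one vertex at a time along the cube order. A lift [c] on
   the vertices below [v] and a lift [e] of a face containing [v] differ by a
   cube that is Gamma-valued strictly below [v], so [c] can be corrected at [v]
   by an element of F_|v| placed on the vertices above [v]. *)
Lemma coset_corner_completion : corner_completion (coset_cubes F Gamma).
Proof.
move=> n c' cornc.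
(* The induction is on the size of a down-closed set [D] of vertices that omits the top one. *)
suff lift m (D : {set cube n.+1}) : #|D| = m ->
    (forall v w, le_cube w v -> v \in D -> w \in D) -> cube1 n.+1 \notin D ->
    exists2 c, group_cubes F n.+1 c &
      forall v : punctured_cube n.+1, sval v \in D -> pr (c (sval v)) = c' v.
  have [||c cc cE] := lift _ (~: [set cube1 n.+1])%SET erefl.
  - move=> v w wv; rewrite !inE; apply: contraNneq => w1.
    by apply/eqP/ffunP => i; have := wv i; rewrite w1 !ffunE => ->.
  - by rewrite !inE eqxx.
  exists (pr \o c); first by exists c.
  by move=> v; apply: cE; rewrite !inE; exact: (svalP v).
elim: m D => [|m IH] D Dm downD topD.
  exists 1; first exact: group_cubes1.
  by move=> v; rewrite (cards0_eq Dm) inE.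
have [u0 Du0] : exists u, u \in D by apply/set0Pn; rewrite -card_gt0 Dm.
(* A vertex of largest weight is maximal in [D], so removing it leaves a down-closed set. *)
pose v := [arg max_(u > u0 in D) weight u].
have [Dv vmax] : v \in D /\ forall u, u \in D -> (weight u <= weight v)%N.
  by rewrite /v; case: arg_maxnP.
have vtop u : u \in D -> le_cube v u -> u = v.
  move=> Du vu; suff : [set i | v i]%SET = [set i | u i]%SET.
    by move=> /setP e; apply/ffunP => i; have := e i; rewrite !inE.
  apply/eqP; rewrite eqEcard vmax // andbT; apply/fintype.subsetP => i.
  by rewrite !inE; exact: vu.
have [|||c cc cE] := IH (D :\ v)%SET.
- by move: Dm; rewrite (cardsD1 v) Dv => -[].
- move=> u w wu; rewrite !inE => /andP[uv Du]; rewrite (downD u w wu Du) andbT.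
  by apply: contraNneq uv => wv; apply/eqP/vtop => //; rewrite -wv.
- by rewrite !inE (negbTE topD) andbF.
(* Since [v] is not the top vertex, it lies on a lower face, where the corner has a lift [e]. *)
have [i vi] : exists i, v i = false.
  suff /forallPn[i nvi] : ~~ [forall i, v i] by exists i; exact: negbTE.
  apply: contra topD => /forallP v1.
  by rewrite (_ : cube1 _ = v) //; apply/ffunP => j; rewrite ffunE v1.
have vE : insert_coord i false (delete_coord i v) = v by rewrite -vi delete_coordK.
have [e ce eE] := cornc i.
have {}eE w : pr (e w) = c' (punctured_face i w) by have := congr1 (fun f => f w) eE.
pose v' := delete_coord i v.
pose d := (c \o insert_coord i false)^-1 * e.
have [||g Fg Kg] := @cube_top _ F n d v' Gamma pF.
- apply: group_cubesM => //; apply: group_cubesV.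
  by apply: group_cubes_comp cc => // j b; exact: insert_coord_coface.
- move=> w wv' wNv'; apply/coset_projP; change (pr (c (insert_coord i false w)) = pr (e w)).
  rewrite eE -(cE (punctured_face i w)) //= !inE; apply/andP; split.
    apply/eqP => ev; apply: wNv'.
    by rewrite /v' -ev insert_coordK.
  apply: downD Dv => j; have [k ->|->] := unliftP i j.
    by rewrite insert_coord_lift => /wv'; rewrite ffunE.
  by rewrite insert_coord_at.
(* Within [D] only [v] lies above [v], so the values already lifted do not change. *)
exists (c * set_elt (upper_set v) g).
  apply: group_cubesM => //; apply: set_elt_cube (coface_upper_set v) _ => //.
  by rewrite -vE weight_insert_coord.
move=> u Du; rewrite fun_mulE /set_elt inE.
have [uv|uv] := eqVneq (sval u) v.
  rewrite uv; have -> : [forall j, v j ==> v j] by apply/forallP => j; exact: implybb.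
  have -> : u = punctured_face i v' by apply: val_inj; exact: etrans uv (esym vE).
  rewrite -eE; apply/coset_projP; move: Kg; rewrite /d fun_mulE fun_invE /= vE.
  by rewrite invgM mulgA.
have -> : [forall j, v j ==> sval u j] = false.
  by apply: contra_neqF uv => /forallP vu; apply: vtop => // j; exact/implyP/vu.
by rewrite mulg1; apply: cE; rewrite !inE uv.
Qed.

Lemma coset_cubespace : (F 0 : set G) = setT -> is_cubespace (coset_cubes F Gamma).
Proof.
move=> F0; split=> [|m n phi _ /cube_morphism_coface phiP [c cc <-]]; last first.
  by exists (c \o phi) => //; exact: group_cubes_comp.
apply/seteqP; split=> // c _.
have [x xE] := coset_proj_surj (c [ffun=> false]).
exists (set_elt [set: cube 0]%SET x).
  by apply: (@set_elt_cube _ _ _ _ 0) => //; [exact: cofaceT|rewrite F0].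
apply/funext => v; rewrite /= /set_elt inE xE; congr (c _).
by apply/ffunP => -[].
Qed.

Lemma coset_ergodic : (F 1 : set G) = setT -> ergodic (coset_cubes F Gamma).
Proof.
move=> F1; apply/seteqP; split=> // c _.
have [x xE] := coset_proj_surj (c [ffun=> false]).
have [y yE] := coset_proj_surj (c [ffun=> true]).
exists (set_elt [set v : cube 1 | v ord0 == false]%SET x *
        set_elt [set v : cube 1 | v ord0 == true]%SET y).
  by apply: group_cubesM; apply: (@set_elt_cube _ _ _ _ 1) => //;
    rewrite ?F1 //; exact: coface_coord.
apply/funext => v; rewrite /= fun_mulE /set_elt !inE.
have -> : v = [ffun=> v ord0] by apply/ffunP => i; rewrite ffunE ord1.
by rewrite ffunE; case: (v ord0); rewrite /= ?mul1g ?mulg1.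
Qed.

Lemma coset_nilspace : (F 0 : set G) = setT -> (F 1 : set G) = setT ->
  nilspace (coset_cubes F Gamma).
Proof.
move=> F0 F1; split; [by exists (pr 1)|exact: coset_cubespace|exact: coset_ergodic|].
exact: coset_corner_completion.
Qed.

End CosetNilspace.

(** * Compactness *)

Section GluedCubes.
Variable G : groupType.
Implicit Types F : nat -> subgroup G.

(** This inverts the passage from a cube to its lower face [a] and the quotient [b] of its two
    faces. *)
Definition glue n (a b : cube n -> G) : cube n.+1 -> G := fun v =>
  a (delete_coord ord0 v) * (if v ord0 then b (delete_coord ord0 v) else 1).

Lemma glue_insert n a b (x : bool) (w : cube n) :
  glue a b (insert_coord ord0 x w) = a w * (if x then b w else 1).
Proof. by rewrite /glue insert_coord_at insert_coordK. Qed.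

(** The factor [a] is pulled back along a projection. Moving [b] to the upper face raises
    codimensions by one, which the shift of the filtration pays for. *)
Lemma glue_cube F n a b : prefiltration F ->
  group_cubes F n a -> group_cubes (filtration_shift F) n b ->
  group_cubes F n.+1 (glue a b).
Proof.
move=> pF ca cb.
pose up (b : cube n -> G) (v : cube n.+1) := if v ord0 then b (delete_coord ord0 v) else 1.
apply: (@group_cubesM _ F n.+1 (a \o delete_coord ord0) (up b)).
  by apply: group_cubes_comp ca => // j x; exact: delete_coord_coface.
move: b cb; apply: (@group_cubes_ind _ _ _ [set b : cube n -> G |
    group_cubes F n.+1 (up b)]).
  apply: mk_subgroup => [|x y cx cy|x cx] /=.
  - rewrite (_ : up 1 = 1); first exact: group_cubes1.
    by apply/funext => v; rewrite /up; case: ifP.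
  - rewrite (_ : up _ = up x * up y); first exact: group_cubesM.
    by apply/funext => v; rewrite fun_mulE /up; case: ifP => //; rewrite mulg1.
  - rewrite (_ : up _ = (up x)^-1); first exact: group_cubesV.
    by apply/funext => v; rewrite fun_invE /up; case: ifP => //; rewrite invg1.
move=> E m g cE Fg /=.
rewrite (_ : up _ = set_elt ([set v : cube n.+1 | v ord0 == true] :&:
    delete_coord ord0 @^-1: E)%SET g).
  apply: (@set_elt_cube _ _ _ _ (1 + m)%N) => //.
  apply: cofaceI; first exact: coface_coord.
  by apply: coface_preim cE => j x; exact: delete_coord_coface.
apply/funext => v; rewrite /up /set_elt !inE.
by case: (v ord0).
Qed.

End GluedCubes.

Lemma compact_cube_lift (G : topologicalGroupType) (F : nat -> subgroup G)
    (K : subgroup G) n : prefiltration F ->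
  (forall i, exists D : set G, [/\ compact D, D `<=` F i &
    forall x, (F i : set G) x -> exists2 a, D a & (K : set G) (a^-1 * x)]) ->
  exists D : set {ptws cube n -> G}, [/\ compact D, D `<=` group_cubes F n &
    forall c, group_cubes F n c ->
      exists2 a, D a & forall v, (K : set G) ((a v)^-1 * c v)].
Proof.
elim: n F => [|n IH] F pF hF.
  have [D [cD DF FD]] := hF 0.
  pose diag (x : G) : {ptws cube 0 -> G} := fun=> x.
  exists (diag @` D); split=> [|_ [x Dx <-]|c cc].
  - apply: continuous_compact => //; apply: continuous_subspaceT.
    by apply: ptws_continuous => v x; exact: cvg_id.
  - rewrite (_ : diag x = set_elt [set: cube 0]%SET x).
      by apply: (@set_elt_cube _ _ _ _ 0) => //; [exact: cofaceT|exact: DF].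
    by apply/funext => v; rewrite /set_elt inE.
  - have [a Da Ka] := FD _ (group_cubes_val [ffun=> false] pF cc).
    exists (diag a) => [|v]; first by exists a.
    by rewrite (_ : v = [ffun=> false]) //; apply/ffunP => -[].
have [D0 [cD0 D0F FD0]] := IH F pF hF.
have [D1 [cD1 D1F FD1]] := IH _ (prefiltration_shift pF) (fun i => hF i.+1).
pose gl (z : {ptws cube n -> G} * {ptws cube n -> G}) : {ptws cube n.+1 -> G} :=
  glue z.1 z.2.
exists (gl @` (D0 `*` D1)); split=> [|_ [[a b] [/= Da Db] <-]|c cc].
- apply: continuous_compact; last exact: compact_setX.
  apply: continuous_subspaceT; apply: ptws_continuous => v.
  pose P := ({ptws cube n -> G} * {ptws cube n -> G})%type.
  have c1 w : continuous (fun z : P => z.1 w).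
    move=> z; apply: (@continuous_comp _ _ _ fst (fun f : {ptws cube n -> G} => f w)).
      exact: cvg_fst.
    exact: ptws_eval_continuous.
  have c2 w : continuous (fun z : P => z.2 w).
    move=> z; apply: (@continuous_comp _ _ _ snd (fun f : {ptws cube n -> G} => f w)).
      exact: cvg_snd.
    exact: ptws_eval_continuous.
  rewrite /gl /glue.
  case: (v ord0); last first.
    exact: (continuous_mulg (c1 (delete_coord ord0 v)) (@cst_continuous P G 1)).
  exact: (continuous_mulg (c1 (delete_coord ord0 v)) (c2 (delete_coord ord0 v))).
- by apply: glue_cube; [|exact: D0F|exact: D1F].
pose c0 := c \o @insert_coord n ord0 false.
pose c1 := c \o @insert_coord n ord0 true.
have cc0 : group_cubes F n c0 by exact: group_cubes_face.
have [a Da Ka] := FD0 _ cc0.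
(* The [K]-valued remainder [gam] of the lower face stands between [a] and the quotient of the two
   faces. Conjugating the quotient by [gam] before applying the second induction hypothesis moves it
   to the right end. *)
pose gam : cube n -> G := (a : cube n -> G)^-1 * c0.
have cgam : group_cubes F n gam.
  by apply: group_cubesM => //; apply: group_cubesV; exact: D0F.
have := group_cubes_normal pF cgam (group_cubesS_diff pF cc).
move=> /FD1[b Db Kb]; exists (gl (a, b)); first by exists (a, b).
move=> v; rewrite -(delete_coordK ord0 v) /gl glue_insert /=.
set w := delete_coord ord0 v; case: (v ord0); last by rewrite mulg1; exact: Ka.
have := subgM (Kb w) (Ka w); congr (subgroup_set _ _).
rewrite /gam !(fun_mulE, fun_invE) /= /c0 /=.
by rewrite !invgM !invgK !mulgA !(mulgVK, mulgK).
Qed.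

(** * Closedness of the cube sets against cocompactness *)

Section CompactCosetSpace.
Variables (G : topologicalGroupType) (F : nat -> subgroup G) (Gamma : subgroup G).
Hypothesis pF : prefiltration F.
Let pr := coset_proj Gamma.

Let lifts i := exists D : set G, [/\ compact D, D `<=` F i &
    forall x, (F i : set G) x -> exists2 a, D a & (Gamma : set G) (a^-1 * x)].

(** A compact set of cubes of the group already has all of [coset_cubes F Gamma n] as its image, and
    compact sets in a Hausdorff space are closed. *)
Lemma coset_cubes_closed n : hausdorff_space (coset_space Gamma) ->
  (forall i, lifts i) ->
  closed (coset_cubes F Gamma n : set {ptws cube n -> coset_space Gamma}).
Proof.
move=> hX hF; have [D [cD DF FD]] := compact_cube_lift n pF hF.
pose f (c : {ptws cube n -> G}) : {ptws cube n -> coset_space Gamma} := pr \o c.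
suff -> : coset_cubes F Gamma n = f @` D.
  apply: compact_closed; first exact: ptws_hausdorff.
  apply: continuous_compact => //; apply: continuous_subspaceT.
  apply: ptws_continuous => v c.
  apply: (@continuous_comp _ _ _ (fun c : {ptws cube n -> G} => c v) pr).
    exact: ptws_eval_continuous.
  exact: coset_proj_continuous.
apply/seteqP; split=> [_ [c cc <-]|_ [a Da <-]]; last by exists a => //; exact: DF.
have [a Da Ka] := FD _ cc; exists a => //.
by apply/funext => v; apply/coset_projP; exact: Ka.
Qed.

(* A cube with value Gamma off its top vertex has its top value in F_i Gamma, so
   the image of F_i is a section of the closed set of cubes of dimension i. *)
Lemma coset_image_closed i : hausdorff_space (coset_space Gamma) ->
  closed (coset_cubes F Gamma i : set {ptws cube i -> coset_space Gamma}) ->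
  closed (pr @` (F i : set G)).
Proof.
move=> hX cC.
pose f (p : coset_space Gamma) : {ptws cube i -> coset_space Gamma} :=
  fun v => if v == cube1 i then p else pr 1.
have cf : continuous f.
  apply: ptws_continuous => v; rewrite /f; case: eqP => _.
    by move=> p; exact: cvg_id.
  exact: cst_continuous.
have weight1 : weight (cube1 i) = i.
  rewrite -[RHS]card_ord /weight -cardsT; congr #|pred_of_set _|.
  by apply/setP => j; rewrite !inE ffunE.
suff -> : pr @` (F i : set G) = f @^-1` (coset_cubes F Gamma i).
  by move/continuous_closedP: cf; apply.
apply/seteqP; split=> [_ [g Fg <-]|p [c cc cE]].
  exists (set_elt (upper_set (cube1 i)) g).
    by apply: set_elt_cube (coface_upper_set _) _ => //; rewrite weight1.
  apply/funext => v; rewrite /= /f /set_elt inE.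
  have -> : [forall j, cube1 i j ==> v j] = (v == cube1 i).
    apply/forallP/eqP => [v1|-> j]; last exact: implybb.
    by apply/ffunP => j; have := v1 j; rewrite ffunE.
  by case: ifP.
have cE' v : pr (c v) = f p v by rewrite -cE.
have [w _ wv|g Fg Kg] := @cube_top _ F i c (cube1 i) Gamma pF cc.
  rewrite -[c w]mul1g -{1}[1]invg1; apply/coset_projP.
  by rewrite -/pr cE' /f; case: eqP.
exists g; first by move: Fg; rewrite weight1.
by have := cE' (cube1 i); rewrite /f eqxx => <-; apply/coset_projP.
Qed.

Lemma lifts_of_closed_image i (C : nat -> set G) :
  hausdorff_space (coset_space Gamma) -> compact [set: coset_space Gamma] ->
  closed (F i : set G) -> closed (pr @` (F i : set G)) ->
  (forall m, compact (C m)) -> \bigcup_m C m = setT -> lifts i.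
Proof.
move=> hX cX cF cY cC CT.
have cprC m : compact (pr @` (C m `&` F i)).
  apply: continuous_compact; last exact: compact_closedI.
  by apply: continuous_subspaceT; exact: coset_proj_continuous.
have [||m [U [oU [p [Uh [h Fh hE]]] UC]]] := compact_baire hX cX cY _
  (fun m => compact_closed hX (cprC m)) _.
- by exists (pr 1); exists 1 => //; exact: subg1.
- move=> _ [x Fx <-]; have [m _ Cx] : (\bigcup_m C m) x by rewrite CT.
  by exists m => //; exists x.
rewrite -hE in Uh.
(* [O g] is the translate of [U] by [g * h^-1]; it contains the coset of [g] because [U] contains
   that of [h]. *)
pose O (g : set_type (F i)) := pr @` ((fun y => h * (set_val g)^-1 * y) @^-1` (pr @^-1` U)).
have oO g : open (O g).
  apply: coset_proj_open.
  move/continuousP: (@mulg_left_continuous G (h * (set_val g)^-1)); apply.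
  by move/continuousP: (@coset_proj_continuous G Gamma); apply.
have cpY : compact (pr @` (F i : set G)) by exact: subclosed_compact cX _.
have [|s sO] := compact_cover_seq cpY oO.
  move=> _ [x Fx <-]; exists (exist _ x (mem_set Fx)) => //; exists x => //=.
  by rewrite mulgVK.
exists (\big[setU/set0]_(g <- s) ( *%g (set_val g * h^-1) @` (C m `&` F i))); split.
- apply: bigsetU_compact => g _; apply: continuous_compact; last exact: compact_closedI.
  by apply: continuous_subspaceT; exact: mulg_left_continuous.
- elim/big_ind : _ => [|A B AH BH x [/AH|/BH]|g _ _ [x [_ Fx] <-]] //.
  apply: subgM => //; apply: subgM; last exact: subgV.
  exact/set_mem/(svalP g).
move=> x Fx; have := sO (pr x) (imageP _ Fx).
rewrite -!bigcup_seq => -[g gs [y /= Uy /coset_projP Kyx]].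
have Fg : (F i : set G) (set_val g) by exact/set_mem/(svalP g).
(* Membership in [U] depends only on the coset, so [y] may be replaced by [x]. *)
have Ux : U (pr (h * (set_val g)^-1 * x)).
  suff <- : pr (h * (set_val g)^-1 * y) = pr (h * (set_val g)^-1 * x) by [].
  by apply/coset_projP; rewrite invgM -mulgA mulKg.
have [|a [Ca Fa] /coset_projP Ka] := UC (pr (h * (set_val g)^-1 * x)).
  split=> //; exists (h * (set_val g)^-1 * x) => //.
  by apply: subgM => //; apply: subgM => //; exact: subgV.
exists (set_val g * h^-1 * a); first by exists g => //; exists a.
by move: Ka; rewrite !invgM invgK !mulgA.
Qed.

End CompactCosetSpace.

Theorem proposition1p1p2 (R : realType) (G : topologicalGroupType)
    (lieG : lie_group R G) (connG : connected [set: G])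
    (nilG : nilpotent_group G)
    (k : nat) (F : nat -> subgroup G)
    (filtF : filtration F) (degF : filtration_degree F k)
    (closedF : forall i, closed (F i : set G))
    (Gamma : subgroup G) (discreteGamma : discrete_subset (Gamma : set G)) :
  connected_compact_nilspace (coset_cubes F Gamma) <->
  (forall i : nat, (1 <= i <= k)%N -> cocompact (trace_subgroup Gamma (F i))).
Proof.
have pF := filtration_pre filtF; have [F0 F1 _ _] := filtF.
have [hG sG _] := lieG; have [N cN nN] := lie_group_locally_compact lieG.
have cGamma := discrete_subgroup_closed hG discreteGamma.
have hX := coset_space_hausdorff cGamma.
split=> [[[_ [cX _ _] clC] _] i _|coc].
  have [C [cC CT]] := group_locally_compact_sigma sG cN nN.
  have [D [cD DF FD]] := lifts_of_closed_image hX cX (closedF i)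
    (coset_image_closed pF hX (clC i)) cC CT.
  exact: cocompact_of_lift hG sG cGamma cD DF FD.
have lifts1 i : (1 <= i)%N -> exists D : set G, [/\ compact D, D `<=` F i &
    forall x, (F i : set G) x -> exists2 a, D a & (Gamma : set G) (a^-1 * x)].
  move=> i0; have [ik|ki] := leqP i k.
    by apply: cocompact_lift cN nN (closedF i) (coc i _); rewrite i0.
  (* Beyond the degree the subgroups are trivial, and the single point 1 is a compact set of
     representatives. *)
  have Fi x : (F i : set G) x -> x = 1.
    by move=> /(prefiltration_le pF ki); rewrite degF.
  exists [set 1]; split=> [|_ ->|x /Fi ->]; [exact: compact_set1|exact: subg1|].
  by exists 1 => //; rewrite mulVg; exact: subg1.
have lifts i : exists D : set G, [/\ compact D, D `<=` F i &
    forall x, (F i : set G) x -> exists2 a, D a & (Gamma : set G) (a^-1 * x)].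
  case: i => [|i]; last exact: lifts1.
  by rewrite F0 -F1; exact: lifts1.
pose pr := coset_proj Gamma.
have prT : pr @` setT = setT.
  by apply/seteqP; split=> // p _; have [x <-] := coset_proj_surj p; exists x.
split.
  split; [exact: coset_nilspace| |by move=> n; exact: coset_cubes_closed].
  split=> //; last exact: coset_space_second_countable.
  (* Since [F 1] is the whole group, the representatives for index 1 map onto the whole coset
     space. *)
  have [D [cD _ FD]] := lifts 1%N.
  suff -> : [set: coset_space Gamma] = pr @` D.
    apply: continuous_compact => //; apply: continuous_subspaceT.
    exact: coset_proj_continuous.
  apply/seteqP; split=> // p _; have [x <-] := coset_proj_surj p.
  by have [|a Da Ka] := FD x; [rewrite F1|exists a => //; exact/coset_projP].
rewrite -prT; apply: connected_continuous_connected => //.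
by apply: continuous_subspaceT; exact: coset_proj_continuous.
Qed.
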